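(* If $f:X\to Y$ is an open perfect mapping between spaces and $Y$ is a star Menger space, then $X$ is star Menger.
   Context: All spaces are assumed to be regular and $T_1$. For a family $\mathcal{U}$ of subsets of $X$ and $A\subseteq X$, $St(A,\mathcal{U})=\bigcup\{U\in\mathcal{U}:U\cap A\neq\emptyset\}$. A space $M$ is Menger if for every sequence $\{\mathcal{U}_n:n\in\omega\}$ of open covers of $M$ there are finite subcollections $\mathcal{V}_n\subseteq\mathcal{U}_n$ ($n\in\omega$) such that $\bigcup\{\mathcal{V}_n:n\in\omega\}$ is an open cover of $M$. A space $X$ is star Menger if for every open cover $\mathcal{U}$ of $X$ there is a subspace $M\subseteq X$ which is Menger and satisfies $St(M,\mathcal{U})=X$. A mapping is perfect if it is continuous, closed and all its fibres $f^{-1}(y)$ are compact. *)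

(* Defs.v *)
From mathcomp Require Import all_boot all_order all_algebra.
From mathcomp Require Import all_classical.
From mathcomp Require Import topology.

Set Implicit Arguments.
Unset Strict Implicit.
Unset Printing Implicit Defensive.

Local Open Scope classical_set_scope.

Definition is_open_cover (X : topologicalType) (U : set (set X)) : Prop :=
  (forall O, U O -> open O) /\ cover U id = [set: X].

Definition star (X : Type) (A : set X) (U : set (set X)) : set X :=
  \bigcup_(O in [set O | U O /\ O `&` A !=set0]) O.

Definition menger (M : topologicalType) : Prop :=
  forall U : nat -> set (set M), (forall n, is_open_cover (U n)) ->
  exists V : nat -> set (set M),
    (forall n, V n `<=` U n /\ finite_set (V n)) /\
    is_open_cover (\bigcup_n V n).

(* [set_type M] carries the initial topology of its inclusion in [X], which is
   the subspace topology; the library's [subspace M] would be wrong here, since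
   it keeps the points outside [M] and makes them isolated. *)
Definition star_menger (X : topologicalType) : Prop :=
  forall U : set (set X), is_open_cover U ->
  exists M : set X, menger (set_type M) /\ star M U = [set: X].

Definition open_map (X Y : topologicalType) (f : X -> Y) : Prop :=
  forall A : set X, open A -> open (f @` A).

Definition closed_map (X Y : topologicalType) (f : X -> Y) : Prop :=
  forall A : set X, closed A -> closed (f @` A).

(* Perfect maps are not required to be surjective. *)
Definition perfect_map (X Y : topologicalType) (f : X -> Y) : Prop :=
  [/\ continuous f, closed_map f & forall y : Y, compact (f @^-1` [set y])].

(* Main.v *)
Require Import Defs.
From mathcomp Require Import all_boot all_order all_algebra.
From mathcomp Require Import all_classical.
From mathcomp Require Import topology.

(** Perfect preimages of Menger spaces are Menger, so it suffices to find a
    Menger [M] in [Y] with [St(f^-1(M), U) = X]. For each [y] choose a finite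
    subfamily [W] of [U] that covers the fibre of [y], every member of which
    meets that fibre. Then [y] lies in the open set
    [O_y = (\bigcap_(V in W) f(V)) `\` f(X `\` \bigcup W)]. Let [M] be a Menger
    star kernel for the cover [{O_y}]. If [f x] lies in some [O_y] meeting [M],
    then [x] lies in a [V in W], and [O_y `<=` f(V)] shows that [V] meets
    [f^-1(M)]. *)

Set Implicit Arguments.
Unset Strict Implicit.
Unset Printing Implicit Defensive.

Local Open Scope classical_set_scope.

(* [compact_cover] in the library requires a pointed space. *)
Lemma compact_finite_subfamily (X : topologicalType) (K : set X)
    (U : set (set X)) :
  compact K -> (forall O, U O -> open O) -> K `<=` cover U id ->
  exists W, [/\ W `<=` U, finite_set W & K `<=` cover W id].
Proof.
move=> cK oU KU; apply: contrapT => noW.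
(* The filter generated by what finite subfamilies of [U] leave uncovered in [K]; it is proper
   exactly because [noW] denies a finite subcover. A cluster point in [K] lies in some [O] in [U],
   yet the filter contains [K] minus [O]. *)
pose F : set_system X := fun A =>
  exists W, [/\ W `<=` U, finite_set W & K `\` cover W id `<=` A].
have PF : ProperFilter F.
  split; last split.
  - move=> [W [WU fW W0]]; apply: noW; exists W; split=> // x Kx.
    by apply: contrapT => nx; exact: (W0 x).
  - by exists set0; split=> //; exact: sub0set.
  - move=> A B [W [WU fW WA]] [W' [WU' fW' WB]].
    exists (W `|` W'); split; first by move=> O [/WU|/WU'].
      by rewrite finite_setU.
    move=> x [Kx nx]; split.
      by apply: WA; split=> // -[O WO Ox]; apply: nx; exists O => //; left.
    by apply: WB; split=> // -[O WO Ox]; apply: nx; exists O => //; right.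
  - move=> A B AB [W [WU fW WA]]; exists W; split=> //.
    exact: subset_trans AB.
have FK : F K by exists set0; split=> // [?|x []].
have [p [Kp clp]] := cK F PF FK.
have [O UO Op] := KU p Kp.
have FO : F (K `\` O).
  exists [set O]; split=> [? ->//||x [Kx nx]]; first exact: finite_set1.
  by split=> // Ox; apply: nx; exists O.
have nO : nbhs p O by apply: open_nbhs_nbhs; split=> //; exact: oU.
by have [q [[_ nq] Oq]] := clp _ _ FO nO.
Qed.

Lemma open_bigcap_finite (T : topologicalType) (I : choiceType) (A : set I)
    (F : I -> set T) :
  finite_set A -> (forall i, A i -> open (F i)) -> open (\bigcap_(i in A) F i).
Proof.
move=> fA oF; rewrite -[X in open X]setCK; apply: closed_openC.
rewrite setC_bigcap; apply: closed_bigcup => // i Ai.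
by apply: open_closedC; exact: oF.
Qed.

Section PerfectMap.
Variables (X Y : topologicalType) (f : X -> Y).
Hypothesis perfect_f : perfect_map f.

(** This set, the tube of [D], consists of the points of [Y] whose whole fibre lies in [D]; its
    complement is the image of a closed set under the closed map [f]. *)
Lemma open_tube (D : set X) : open D -> open (~` (f @` ~` D)).
Proof.
have [_ closed_f _] := perfect_f.
by move=> oD; apply: closed_openC; apply: closed_f; exact: open_closedC.
Qed.

Lemma preimage_tube (D : set X) : f @^-1` (~` (f @` ~` D)) `<=` D.
Proof. by move=> x nx; apply: contrapT => Dx; apply: nx; exists x. Qed.

Lemma fibre_tube (D : set X) y : f @^-1` [set y] `<=` D -> (~` (f @` ~` D)) y.
Proof. by move=> yD [x nDx fx]; apply: nDx; exact: yD. Qed.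

(** Compact fibres and tubes make the open sets of [Y] whose preimage is finitely covered by [U n] a
    cover [G n] of [Y]. Each set in a Menger selection from the [G n] is then traded for its finite
    cover upstairs. *)
Lemma menger_perfect_preimage : menger Y -> menger X.
Proof.
move=> mY U cU; have [_ _ cf] := perfect_f.
pose G n : set (set Y) := fun O => open O /\
  exists W, [/\ W `<=` U n, finite_set W & f @^-1` O `<=` cover W id].
have cG n : is_open_cover (G n).
  split=> [O []//|]; apply/seteqP; split=> // y _.
  have [oU UT] := cU n.
  have [|W [WU fW yW]] := compact_finite_subfamily (cf y) oU.
    by rewrite UT.
  exists (~` (f @` ~` cover W id)); last exact: fibre_tube.
  split; last by exists W; split=> //; exact: preimage_tube.
  by apply: open_tube; apply: bigcup_open => O WO; apply/oU/WU.
have [V [VG [_ VT]]] := mY G cG.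
(* The choice is indexed by pairs because one open set may lie in several [G n]; [set0] is a dummy
   value outside [G]. *)
have /choice[w wP] (p : nat * set Y) : exists W, G p.1 p.2 ->
    [/\ W `<=` U p.1, finite_set W & f @^-1` p.2 `<=` cover W id].
  have [[_ [W ?]]|nG] := pselect (G p.1 p.2); first by exists W.
  by exists set0.
exists (fun n => \bigcup_(O in V n) w (n, O)); split.
  move=> n; have [VGn fV] := VG n; split.
    by move=> O [P VP]; have [wU _ _] := wP (n, P) (VGn _ VP); exact: wU.
  apply: bigcup_finite => // P VP.
  by have [] := wP (n, P) (VGn _ VP).
split.
  move=> O [n _ [P VP wO]]; have [oU _] := cU n.
  have [wU _ _] := wP (n, P) ((VG n).1 _ VP).
  by apply: oU; exact: wU.
apply/seteqP; split=> // x _.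
have [O [n _ VO] Ofx] : cover (\bigcup_n V n) id (f x) by rewrite VT.
have [_ _ fO] := wP (n, O) ((VG n).1 _ VO).
have [P wP' Px] := fO x Ofx.
by exists P => //; exists n => //; exists O.
Qed.

End PerfectMap.

Section Corestriction.
Variables (X Y : topologicalType) (f : X -> Y).
Hypothesis perfect_f : perfect_map f.

(** Taking the full preimage of [M] as domain is what keeps the map closed and its fibres
    compact. *)
Definition corestrict (M : set Y) (x : set_type (f @^-1` M)) : set_type M :=
  SigSub (mem_set (set_valP x : M (f (set_val x)))).

Lemma perfect_corestrict (M : set Y) : perfect_map (@corestrict M).
Proof.
have [ctsf closed_f cf] := perfect_f.
split.
- apply/continuousP => A [O oO <-].
  exists (f @^-1` O); last by [].
  by apply: open_comp => // x _; exact: ctsf.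
- move=> C /closed_openC [O oO OC].
  have cO : closed (f @` ~` O) by apply: closed_f; exact: open_closedC.
  (* [C] is the trace of the complement of [O]; any point of that complement sent into [M] already
     belongs to the domain, so images and traces commute. *)
  suff -> : @corestrict M @` C = set_val @^-1` (f @` ~` O).
    apply: preimage_closed cO => m _.
    exact: (@initial_continuous (set_type M) Y set_val).
  have CE x : C x <-> ~ O (set_val x).
    split=> [Cx Ox|nOx]; last first.
      by apply: contrapT => nC; apply: nOx; have : (~` C) x by []; rewrite -OC.
    by have : (set_val @^-1` O) x by []; rewrite OC; exact.
  apply/seteqP; split=> [_ [x Cx <-]|m [x nOx fx]].
    by exists (set_val x) => //; apply/CE.
  have Mx : (f @^-1` M) x by rewrite /preimage /= fx; exact: set_valP.
  exists (SigSub (mem_set Mx)); first by apply/CE.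
  by apply: val_inj.
- move=> m F PF Fm.
  (* Push [F] forward along the inclusion and cluster in the compact fibre of [f]; the cluster point
     maps to [m], hence lies over [M]. *)
  pose H : set_system X := [set A | F (set_val @^-1` A)].
  have PH : ProperFilter H by exact: fmap_proper_filter.
  have Hm : H (f @^-1` [set set_val m]).
    by apply: (@filterS _ F _ _ _ _ Fm) => x xm; rewrite /preimage /= -xm.
  have [x [fx clx]] := cf (set_val m) H PH Hm.
  have Mx : (f @^-1` M) x by rewrite /preimage /= fx; exact: set_valP.
  exists (SigSub (mem_set Mx)); split; first exact: val_inj.
  move=> A B FA; rewrite nbhsE => -[_ [[O oO <-] Ox] OB].
  have HA : H (set_val @` A) by apply: (@filterS _ F _ _ _ _ FA) => a Aa; exists a.
  have nO : nbhs x O by exact: open_nbhs_nbhs.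
  have [_ [[a Aa <-] Oa]] := clx _ _ HA nO.
  by exists a; split=> //; exact: OB.
Qed.

Lemma star_menger_open_perfect :
  open_map f -> star_menger Y -> star_menger X.
Proof.
move=> open_f smY U [oU UT]; have [_ _ cf] := perfect_f.
have /choice[w wP] y : exists W, [/\ W `<=` U, finite_set W,
    f @^-1` [set y] `<=` cover W id & forall V, W V -> (f @` V) y].
  (* Compactness is applied only to the members of [U] that meet the fibre of [y]. Over an empty
     fibre this forces [w y] to be empty, and [O y] below is the complement of the image of [f]. *)
  have [||W [WU fW yW]] := @compact_finite_subfamily _ _
      (U `&` [set V | (f @` V) y]) (cf y).
  - by move=> O [/oU].
  - move=> x fx; have [O UO Ox] : cover U id x by rewrite UT.
    by exists O => //; split=> //; exists x.
  by exists W; split=> // [V /WU[]|V /WU[]].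
pose O y := (\bigcap_(V in w y) (f @` V)) `&`
  ~` (f @` ~` cover (w y) id).
have [|M [mM StM]] := smY (range O).
  split=> [_ [y _ <-]|].
    have [wU fw _ _] := wP y.
    apply: openI.
      by apply: open_bigcap_finite => // V /wU/oU; exact: open_f.
    by apply: (open_tube perfect_f); apply: bigcup_open => V /wU/oU.
  apply/seteqP; split=> // y _; have [_ _ yw wy] := wP y.
  by exists (O y); [exists y | split=> //; exact: fibre_tube].
exists (f @^-1` M); split.
  exact: menger_perfect_preimage (perfect_corestrict M) mM.
apply/seteqP; split=> // x _.
have [_ [[y _ <-] [m [[Om _] Mm]]] [_ Ox]] : star M (range O) (f x).
  by rewrite StM.
have [wU _ _ _] := wP y.
(* The two factors of [O y] act at different points: the tube at [f x], the intersection of images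
   at [m]. *)
have [V wV Vx] := preimage_tube Ox.
have [v Vv fv] := Om _ wV.
exists V => //; split; first exact: wU.
by exists v; split=> //; rewrite /preimage /= fv.
Qed.

End Corestriction.

Theorem proposition4p17 (X Y : topologicalType)
    (regX : regular_space X) (T1X : accessible_space X)
    (regY : regular_space Y) (T1Y : accessible_space Y)
    (f : X -> Y) (open_f : open_map f) (perfect_f : perfect_map f)
    (smY : star_menger Y) :
  star_menger X.
Proof. exact: star_menger_open_perfect perfect_f open_f smY. Qed.
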